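(* For all $x,y,\xi\in[0,1]$, $$H(\xi,y)-H(\xi,x)=W(y)-W(x)-\int_x^yS(\xi,z)\,dz.$$
   Context: The Weierstrass curve is $W(x)=\sum_{n=0}^\infty 2^{-n/2}\begin{pmatrix}\cos(2\pi 2^n x)\\ \sin(2\pi 2^n x)\end{pmatrix}$, $x\in[0,1]$. Baker transformation: for $(\xi,x)\in[0,1]^2$ write $\xi=\sum_{n\ge 0}\overline{\xi}_{-n}2^{-(n+1)}$ and $x=\sum_{n\ge1}\overline{x}_n2^{-n}$ with digits in $\{0,1\}$, where for dyadic points the expansion that is not eventually $0$ is chosen (the number $0$ has all digits $0$). For integers $k\ge0$, $$B^k(\xi,x)=\Big(2^k\xi\ (\mathrm{mod}\ 1),\ \frac{\overline{\xi}_{-k+1}}{2}+\frac{\overline{\xi}_{-k+2}}{2^2}+\cdots+\frac{\overline{\xi}_0}{2^k}+\frac{x}{2^k}\Big),$$ and for $k\ge1$, $$B^{-k}(\xi,x)=\Big(\frac{\xi}{2^k}+\frac{\overline{x}_1}{2^k}+\frac{\overline{x}_2}{2^{k-1}}+\cdots+\frac{\overline{x}_k}{2},\ 2^kx\ (\mathrm{mod}\ 1)\Big),$$ where mod $1$ means deleting the first $k$ digits of the chosen expansion. Write $B^k=(B^k_1,B^k_2)$. With $\gamma=2^{-1/2}$, $$S(\xi,x)=-2\pi\sum_{n=1}^\infty\gamma^n\begin{pmatrix}-\sin(2\pi B_2^n(\xi,x))\\ \cos(2\pi B_2^n(\xi,x))\end{pmatrix},$$ $$H(\xi,x)=\sum_{n\in\mathbb{Z}}2^{-n/2}\left[\begin{pmatrix}\cos(2\pi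 B_2^{-n}(\xi,x))\\ \sin(2\pi B_2^{-n}(\xi,x))\end{pmatrix}-\begin{pmatrix}\cos(2\pi B_2^{-n}(\xi,0))\\ \sin(2\pi B_2^{-n}(\xi,0))\end{pmatrix}\right].$$ *)

(* Defs.v *)
From Stdlib Require Import Reals Lra Lia ZArith ClassicalEpsilon.
From Coquelicot Require Import Coquelicot.
Open Scope R_scope.

(** * Vectors of the plane *)

Definition cis (t : R) : R * R := (cos (2 * PI * t), sin (2 * PI * t)).

(** [Series] and [RInt] do not cover values in [R * R], so sums and integrals of
    vectors are taken componentwise.  [RInt] is oriented, so is [RInt2]. *)
Definition Series2 (a : nat -> R * R) : R * R :=
  (Series (fun n => fst (a n)), Series (fun n => snd (a n))).

Definition SeriesZ2 (a : Z -> R * R) : R * R :=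
  plus (Series2 (fun n => a (Z.of_nat n)))
       (Series2 (fun n => a (- Z.of_nat (S n))%Z)).

Definition RInt2 (f : R -> R * R) (a b : R) : R * R :=
  (RInt (fun z => fst (f z)) a b, RInt (fun z => snd (f z)) a b).

(** * Binary digits *)

(** [d n] is the digit of weight [2^-(n+1)].  Only dyadic points have two
    expansions, and the expansion of a nondyadic point is never eventually 0, so
    requiring this of all nonzero points chooses nothing for the nondyadic ones. *)
Definition is_chosen_expansion (x : R) (d : nat -> R) : Prop :=
  (forall n, d n = 0 \/ d n = 1) /\
  is_series (fun n => d n / 2 ^ S n) x /\
  (x = 0 -> forall n, d n = 0) /\
  (x <> 0 -> ~ exists N, forall n, (N <= n)%nat -> d n = 0).

Definition digit (x : R) : nat -> R :=
  epsilon (inhabits (fun _ : nat => 0)) (is_chosen_expansion x).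

(** Greedy computation of the chosen expansion, used only to show that [digit]
    meets its specification on the unit interval. *)
Definition lead (r : R) : R := if Rlt_dec (1 / 2) r then 1 else 0.

Fixpoint residue (x : R) (n : nat) : R :=
  match n with
  | O => x
  | S m => 2 * residue x m - lead (residue x m)
  end.

Lemma chosen_expansion_exists (x : R) :
  0 <= x <= 1 -> exists d, is_chosen_expansion x d.
Proof.
intros Hx.
assert (Hr : forall n, 0 <= residue x n <= 1).
{ induction n as [|n IH]; simpl; [exact Hx|].
  unfold lead; destruct (Rlt_dec (1 / 2) (residue x n)); lra. }
assert (Hp : forall n, 0 < 2 ^ n) by (intros n; apply pow_lt; lra).
assert (Hs : forall n, sum_n (fun k => lead (residue x k) / 2 ^ S k) n
                       = x - residue x (S n) * (/ 2) ^ S n).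
{ intros n; rewrite pow_inv.
  induction n as [|n IH].
  - rewrite sum_O; simpl; field.
  - rewrite sum_Sn, IH; unfold plus; simpl.
    field; apply Rgt_not_eq, Hp. }
exists (fun n => lead (residue x n)); split; [|split; [|split]].
- intros n; unfold lead; destruct (Rlt_dec _ _); auto.
- change (is_lim_seq (sum_n (fun k => lead (residue x k) / 2 ^ S k)) x).
  assert (Hg : is_lim_seq (fun n => (/ 2) ^ S n) 0).
  { apply (is_lim_seq_incr_1 (fun n => (/ 2) ^ n)), is_lim_seq_geom.
    rewrite Rabs_right; lra. }
  apply is_lim_seq_le_le with (u := fun n => x - (/ 2) ^ S n) (w := fun _ => x).
  + intros n; rewrite Hs.
    assert (0 < (/ 2) ^ S n) by (apply pow_lt; lra).
    specialize (Hr (S n)); nra.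
  + replace x with (x - 0) at 1 by ring.
    apply is_lim_seq_minus'; [apply is_lim_seq_const | exact Hg].
  + apply is_lim_seq_const.
- intros H0 n.
  assert (Hn : residue x n = 0).
  { induction n as [|n IH]; simpl; [exact H0|].
    rewrite IH; unfold lead; destruct (Rlt_dec _ _); lra. }
  rewrite Hn; unfold lead; destruct (Rlt_dec _ _); lra.
- intros H0 [N HN].
  assert (Hpos : forall n, 0 < residue x n).
  { induction n as [|n IH]; simpl; [lra|].
    unfold lead; destruct (Rlt_dec _ _); lra. }
  assert (Hk : forall k, residue x (N + k) = 2 ^ k * residue x N).
  { induction k as [|k IH].
    - rewrite Nat.add_0_r; simpl; ring.
    - rewrite Nat.add_succ_r; simpl; rewrite HN, IH by lia; ring. }
  destruct (Pow_x_infinity 2) with (b := 2 / residue x N) as [M HM].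
  { rewrite Rabs_right; lra. }
  specialize (HM M (le_n M)).
  rewrite Rabs_right in HM by (left; apply Hp).
  specialize (Hk M); pose proof (Hr (N + M)%nat); pose proof (Hpos N).
  assert (2 / residue x N * residue x N = 2) by (field; lra).
  nra.
Qed.

Lemma digit_spec (x : R) : 0 <= x <= 1 -> is_chosen_expansion x (digit x).
Proof.
intros Hx; unfold digit; apply epsilon_spec, chosen_expansion_exists, Hx.
Qed.

(** [2^k x (mod 1)].  It is 1, not 0, if all the remaining digits are 1. *)
Definition shift (k : nat) (x : R) : R :=
  Series (fun n => digit x (n + k) / 2 ^ S n).

(** * The baker transformation *)

(** The digit written [xi_{-n}] is [digit xi n], and [x_n] is [digit x (n - 1)]. *)
Definition baker_fwd (k : nat) (p : R * R) : R * R :=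
  let (xi, x) := p in
  (shift k xi,
   sum_n_m (fun j => digit xi (k - j) / 2 ^ j) 1 k + x / 2 ^ k).

Definition baker_bwd (k : nat) (p : R * R) : R * R :=
  let (xi, x) := p in
  (xi / 2 ^ k + sum_n_m (fun j => digit x (j - 1) / 2 ^ (k + 1 - j)) 1 k,
   shift k x).

Definition B (k : Z) (p : R * R) : R * R :=
  if (0 <=? k)%Z then baker_fwd (Z.to_nat k) p else baker_bwd (Z.to_nat (- k)) p.

Definition B2 (k : Z) (xi x : R) : R := snd (B k (xi, x)).

(** * The Weierstrass curve and the functions S and H *)

Definition gamma : R := Rpower 2 (- (1 / 2)).

Definition Wcurve (x : R) : R * R :=
  Series2 (fun n => scal (Rpower 2 (- INR n / 2)) (cis (2 ^ n * x))).

Definition Sfun (xi x : R) : R * R :=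
  scal (- 2 * PI)
    (Series2 (fun m => let n := S m in
       let t := B2 (Z.of_nat n) xi x in
       scal (gamma ^ n) (- sin (2 * PI * t), cos (2 * PI * t)))).

Definition Hfun (xi x : R) : R * R :=
  SeriesZ2 (fun n => scal (Rpower 2 (- IZR n / 2))
                       (minus (cis (B2 (- n) xi x)) (cis (B2 (- n) xi 0)))).

(* Main.v *)
From Stdlib Require Import ZArith.
Require Import Defs.
From Stdlib Require Import Reals Lra Lia.
From Coquelicot Require Import Coquelicot.
Open Scope R_scope.

(** Each coordinate of the identity is the same statement about a 1-periodic
    function [phi] with derivative [2 * PI * psi], namely the cosine or the
    sine of [2 * PI * t].  The two halves of the series [H] behave differently.

    In a term of index [n >= 0] the baker transformation expands [x], and
    [B2 (- n) xi x] is [2 ^ n * x] up to an integer ([shift_mod_1]), so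
    periodicity turns this half into [W x - W 0] ([expanding_half]).

    In a term of index [- n < 0] it contracts [x]: [B2 n xi x] is
    [c + x / 2 ^ n] with [c] depending on [xi] only.  The term
    [2 ^ (n / 2) * (phi (c + x / 2 ^ n) - phi c)] is therefore the integral
    from 0 to [x] of [2 * PI * gamma ^ n * psi (c + z / 2 ^ n)], which is a
    term of [- S].  These integrands are dominated by the geometric series of
    ratio [gamma < 1], so the sum may be integrated termwise
    ([is_RInt_Series]), and this half is minus the integral of [S] from 0 to
    [x] ([contracting_half]).  Subtracting the values at [x] from those at [y]
    removes the base point 0. *)

(** * Termwise integration *)

Lemma Series_tail_bound (a M : nat -> R) (N : nat) :
  (forall n, Rabs (a n) <= M n) -> ex_series M ->
  Rabs (Series a - sum_n a N) <= Series M - sum_n M N.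
Proof.
intros Ha HM.
assert (Hexa : ex_series a) by (apply (ex_series_le a M); assumption).
assert (HMt : ex_series (fun k => M (S N + k)%nat))
  by (apply (ex_series_incr_n M (S N)), HM).
rewrite (Series_incr_n a (S N)), (Series_incr_n M (S N)) by (lia || assumption).
rewrite !sum_n_Reals; simpl Init.Nat.pred.
match goal with |- Rabs (?s + ?t - ?s) <= ?s' + ?t' - ?s' =>
  replace (s + t - s) with t by ring; replace (s' + t' - s') with t' by ring end.
eapply Rle_trans.
- apply Series_Rabs.
  apply (@ex_series_le R_AbsRing R_CompleteNormedModule _ (fun k => M (S N + k)%nat));
    [|exact HMt].
  intros n; change (norm ?u) with (Rabs u); rewrite Rabs_Rabsolu; apply Ha.
- apply Series_le; [|exact HMt].
  intros n; split; [apply Rabs_pos | apply Ha].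
Qed.

Lemma is_RInt_sum_n (f : nat -> R -> R) (I : nat -> R) (a b : R) (N : nat) :
  (forall n, is_RInt (f n) a b (I n)) ->
  is_RInt (fun z => sum_n (fun n => f n z) N) a b (sum_n I N).
Proof.
intros HI; induction N as [|N IH].
- rewrite sum_O; apply is_RInt_ext with (2 := HI O).
  intros z _; rewrite sum_O; reflexivity.
- rewrite sum_Sn.
  apply is_RInt_ext with (fun z => plus (sum_n (fun n => f n z) N) (f (S N) z)).
  + intros z _; rewrite sum_Sn; reflexivity.
  + apply (is_RInt_plus (V := R_NormedModule)); auto.
Qed.

(** The Weierstrass M-test: the tails of [M] bound the distance from the partial
    sums to the limit uniformly in [z], and uniform limits pass through the
    integral. *)
Lemma is_RInt_Series (f : nat -> R -> R) (M I : nat -> R) (a b : R) :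
  (forall n z, Rabs (f n z) <= M n) -> ex_series M ->
  (forall n, is_RInt (f n) a b (I n)) ->
  is_RInt (fun z => Series (fun n => f n z)) a b (Series I).
Proof.
intros Hf HM HI.
destruct (@filterlim_RInt nat R_CompleteNormedModule
  (fun N z => sum_n (fun n => f n z) N) a b eventually _
  (fun z => Series (fun n => f n z)) (sum_n I)) as [J [HJ Hint]].
- intros N; apply is_RInt_sum_n, HI.
- apply filterlim_locally; intros eps.
  destruct (proj1 (filterlim_locally _ _) (Series_correct _ HM) eps) as [N0 HN0].
  exists N0; intros N HN z; specialize (HN0 N HN).
  change (Rabs (sum_n (fun n => f n z) N - Series (fun n => f n z)) < eps).
  change (Rabs (sum_n M N - Series M) < eps) in HN0.
  rewrite Rabs_minus_sym; rewrite Rabs_minus_sym in HN0.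
  eapply Rle_lt_trans; [apply Series_tail_bound; [intros n; apply Hf | exact HM]|].
  eapply Rle_lt_trans; [apply Rle_abs | exact HN0].
- replace (Series I) with J; [exact Hint|].
  symmetry; apply is_series_unique, HJ.
Qed.

(** * Powers of [gamma] *)

Lemma gamma_bounds : 0 < gamma < 1.
Proof.
unfold gamma; split; [apply exp_pos|].
apply Rlt_le_trans with (Rpower 2 0); [apply Rpower_lt; lra|].
rewrite Rpower_O; lra.
Qed.

Lemma gamma_pow (n : nat) : gamma ^ n = Rpower 2 (- INR n / 2).
Proof.
rewrite <- Rpower_pow by apply gamma_bounds.
unfold gamma; rewrite Rpower_mult; f_equal; field.
Qed.

Lemma gamma_weight_neg (n : nat) :
  Rpower 2 (- IZR (- Z.of_nat n) / 2) = 2 ^ n * gamma ^ n.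
Proof.
rewrite gamma_pow, <- Rpower_pow, <- Rpower_plus, opp_IZR, <- INR_IZR_INZ by lra.
f_equal; field.
Qed.

Lemma ex_series_gamma : ex_series (fun n => gamma ^ n).
Proof.
apply ex_series_geom; pose proof gamma_bounds; rewrite Rabs_right; lra.
Qed.

Lemma ex_series_gamma_bounded (a : nat -> R) :
  (forall n, Rabs (a n) <= 1) -> ex_series (fun n => gamma ^ n * a n).
Proof.
intros Ha; apply (@ex_series_le R_AbsRing R_CompleteNormedModule _ (fun n => gamma ^ n));
  [|exact ex_series_gamma].
intros n; change (norm ?u) with (Rabs u).
assert (H : 0 < gamma ^ n) by apply pow_lt, gamma_bounds.
rewrite Rabs_mult, (Rabs_right (gamma ^ n)) by lra.
specialize (Ha n); nra.
Qed.

(** * The second coordinate of the baker transformation *)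

Lemma shift_0 (x : R) : 0 <= x <= 1 -> shift 0 x = x.
Proof.
intros Hx; destruct (digit_spec x Hx) as [_ [Hs _]].
rewrite <- (is_series_unique _ _ Hs) at 2; apply Series_ext; intros n.
rewrite Nat.add_0_r; reflexivity.
Qed.

Lemma ex_series_digits (d : nat -> R) :
  (forall n, d n = 0 \/ d n = 1) -> ex_series (fun n => d n / 2 ^ S n).
Proof.
intros Hd; apply (@ex_series_le R_AbsRing R_CompleteNormedModule _ (fun n => (/ 2) ^ n)).
- intros n; change (norm ?u) with (Rabs u).
  rewrite pow_inv; simpl.
  assert (0 < / 2 ^ n) by (apply Rinv_0_lt_compat, pow_lt; lra).
  unfold Rdiv; rewrite Rinv_mult.
  apply Rabs_le; destruct (Hd n) as [-> | ->]; lra.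
- apply ex_series_geom; rewrite Rabs_right; lra.
Qed.

Lemma shift_S (k : nat) (x : R) :
  0 <= x <= 1 -> shift (S k) x = 2 * shift k x - digit x k.
Proof.
intros Hx; destruct (digit_spec x Hx) as [Hd _].
unfold shift at 2.
rewrite Series_incr_1 by (apply (ex_series_digits (fun n => digit x (n + k))); auto).
replace (Series (fun n => digit x (S n + k) / 2 ^ S (S n))) with (/ 2 * shift (S k) x).
- simpl; field.
- unfold shift; rewrite <- Series_scal_l; apply Series_ext; intros n.
  replace (n + S k)%nat with (S n + k)%nat by lia.
  simpl; field; apply pow_nonzero; lra.
Qed.

(** The natural number [m] is the integer whose binary digits are the [k]
    deleted ones. *)
Lemma shift_mod_1 (k : nat) (x : R) :
  0 <= x <= 1 -> exists m : nat, 2 ^ k * x = shift k x + INR m.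
Proof.
intros Hx; induction k as [|k [m IH]].
- exists O; rewrite shift_0 by exact Hx; simpl; ring.
- rewrite shift_S by exact Hx.
  destruct (digit_spec x Hx) as [Hd _]; destruct (Hd k) as [E | E]; rewrite E.
  + exists (2 * m)%nat; rewrite mult_INR; simpl; nra.
  + exists (2 * m + 1)%nat; rewrite plus_INR, mult_INR; simpl; nra.
Qed.

Lemma B2_contracting (n : nat) (xi z : R) :
  B2 (Z.of_nat n) xi z =
  sum_n_m (fun j => digit xi (n - j) / 2 ^ j) 1 n + z / 2 ^ n.
Proof.
unfold B2, B.
replace (0 <=? Z.of_nat n)%Z with true by (symmetry; apply Z.leb_le; lia).
rewrite Nat2Z.id; reflexivity.
Qed.

Lemma B2_expanding (n : nat) (xi x : R) :
  0 <= x <= 1 -> B2 (- Z.of_nat n) xi x = shift n x.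
Proof.
intros Hx; destruct n as [|n].
- change (- Z.of_nat 0)%Z with (Z.of_nat 0).
  rewrite B2_contracting, sum_n_m_zero by lia.
  rewrite shift_0 by exact Hx; unfold zero; simpl; field.
- unfold B2, B.
  replace (0 <=? - Z.of_nat (S n))%Z with false by (symmetry; apply Z.leb_gt; lia).
  rewrite Z.opp_involutive, Nat2Z.id; reflexivity.
Qed.

(** * The two halves of [H], one coordinate at a time *)

(** What the cosine and the sine of [2 * PI * t] have in common; [psi] is the
    derivative of [phi] divided by [2 * PI]. *)
Record is_wave (phi psi : R -> R) : Prop := {
  wave_bounded : forall t, Rabs (phi t) <= 1;
  wave_derive_bounded : forall t, Rabs (psi t) <= 1;
  wave_derive : forall t, is_derive phi t (2 * PI * psi t);
  wave_derive_continuous : forall t, continuous psi t;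
  wave_periodic : forall t m, phi (t + INR m) = phi t }.

Lemma sin_turns_bounded (t : R) : Rabs (sin (2 * PI * t)) <= 1.
Proof. apply Rabs_le, SIN_bound. Qed.

Lemma cos_turns_bounded (t : R) : Rabs (cos (2 * PI * t)) <= 1.
Proof. apply Rabs_le, COS_bound. Qed.

Lemma is_wave_cos :
  is_wave (fun t => cos (2 * PI * t)) (fun t => - sin (2 * PI * t)).
Proof.
split.
- exact cos_turns_bounded.
- intros t; rewrite Rabs_Ropp; apply sin_turns_bounded.
- intros t; auto_derive; [trivial | ring].
- intros t; apply (ex_derive_continuous (V := R_NormedModule)); auto_derive; trivial.
- intros t m; rewrite <- (cos_period (2 * PI * t) m); f_equal; ring.
Qed.

Lemma is_wave_sin :
  is_wave (fun t => sin (2 * PI * t)) (fun t => cos (2 * PI * t)).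
Proof.
split.
- exact sin_turns_bounded.
- exact cos_turns_bounded.
- intros t; auto_derive; [trivial | ring].
- intros t; apply (ex_derive_continuous (V := R_NormedModule)); auto_derive; trivial.
- intros t m; rewrite <- (sin_period (2 * PI * t) m); f_equal; ring.
Qed.

Lemma wave_B2_expanding (phi psi : R -> R) (n : nat) (xi x : R) :
  is_wave phi psi -> 0 <= x <= 1 ->
  phi (B2 (- Z.of_nat n) xi x) = phi (2 ^ n * x).
Proof.
intros Hw Hx; rewrite B2_expanding by exact Hx.
destruct (shift_mod_1 n x Hx) as [m ->].
rewrite (wave_periodic _ _ Hw); reflexivity.
Qed.

Lemma expanding_half (phi psi : R -> R) (xi x : R) :
  is_wave phi psi -> 0 <= x <= 1 ->
  Series (fun n => Rpower 2 (- IZR (Z.of_nat n) / 2)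
            * (phi (B2 (- Z.of_nat n) xi x) - phi (B2 (- Z.of_nat n) xi 0)))
  = Series (fun n => Rpower 2 (- INR n / 2) * phi (2 ^ n * x))
    - Series (fun n => Rpower 2 (- INR n / 2) * phi (2 ^ n * 0)).
Proof.
intros Hw Hx.
assert (Hex : forall z, ex_series (fun n => Rpower 2 (- INR n / 2) * phi (2 ^ n * z))).
{ intros z.
  apply ex_series_ext with (fun n => gamma ^ n * phi (2 ^ n * z)).
  - intros n; rewrite gamma_pow; reflexivity.
  - apply ex_series_gamma_bounded; intros n; apply (wave_bounded _ _ Hw). }
rewrite <- Series_minus by apply Hex.
apply Series_ext; intros n.
rewrite !(wave_B2_expanding phi psi) by (assumption || lra).
rewrite <- INR_IZR_INZ; ring.
Qed.

(** The chain rule gives a factor [/ 2 ^ n], which turns the weight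
    [2 ^ (n / 2)] of this term of [H] into the weight [gamma ^ n] of [S]. *)
Lemma contracting_term (phi psi : R -> R) (n : nat) (xi a b : R) :
  is_wave phi psi ->
  is_RInt (fun z => 2 * PI * (gamma ^ n * psi (B2 (Z.of_nat n) xi z))) a b
    (Rpower 2 (- IZR (- Z.of_nat n) / 2)
       * (phi (B2 (Z.of_nat n) xi b) - phi (B2 (Z.of_nat n) xi a))).
Proof.
intros Hw; rewrite gamma_weight_neg, !B2_contracting.
assert (H2 : 2 ^ n <> 0) by (apply pow_nonzero; lra).
set (c := sum_n_m _ 1 n).
apply is_RInt_ext with (fun z => 2 * PI * (gamma ^ n * psi (c + z / 2 ^ n))).
{ intros z _; rewrite B2_contracting; reflexivity. }
rewrite Rmult_minus_distr_l.
apply (is_RInt_derive (V := R_CompleteNormedModule)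
         (fun z => 2 ^ n * gamma ^ n * phi (c + z / 2 ^ n))).
- intros z _.
  evar_last.
  + apply is_derive_scal, (is_derive_comp phi (fun z => c + z / 2 ^ n)).
    * apply (wave_derive _ _ Hw).
    * auto_derive; [trivial | reflexivity].
  + unfold scal; simpl; unfold mult; simpl; field; exact H2.
- intros z _.
  apply (continuous_scal_r (K := R_AbsRing) (V := R_NormedModule) (2 * PI)
    (fun z => gamma ^ n * psi (c + z / 2 ^ n))).
  apply (continuous_scal_r (K := R_AbsRing) (V := R_NormedModule) (gamma ^ n)
    (fun z => psi (c + z / 2 ^ n))).
  apply continuous_comp with (f := fun z => c + z / 2 ^ n).
  + apply (ex_derive_continuous (V := R_NormedModule)); auto_derive; trivial.
  + apply (wave_derive_continuous _ _ Hw).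
Qed.

Lemma contracting_half (phi psi : R -> R) (xi a b : R) :
  is_wave phi psi ->
  is_RInt (fun z => - 2 * PI * Series (fun m => gamma ^ S m * psi (B2 (Z.of_nat (S m)) xi z)))
    a b
    (- Series (fun m => Rpower 2 (- IZR (- Z.of_nat (S m)) / 2)
       * (phi (B2 (Z.of_nat (S m)) xi b) - phi (B2 (Z.of_nat (S m)) xi a)))).
Proof.
intros Hw.
apply is_RInt_ext with (fun z => opp (Series (fun m =>
  2 * PI * (gamma ^ S m * psi (B2 (Z.of_nat (S m)) xi z))))).
{ intros z _; rewrite Series_scal_l; unfold opp; simpl; ring. }
apply (is_RInt_opp (V := R_NormedModule)).
apply is_RInt_Series with (M := fun m => 2 * PI * gamma ^ S m).
- intros m z; pose proof PI_RGT_0.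
  assert (Hg : 0 < gamma ^ S m) by apply pow_lt, gamma_bounds.
  rewrite !Rabs_mult, (Rabs_right (gamma ^ S m)), (Rabs_right 2), (Rabs_right PI) by lra.
  apply Rmult_le_compat_l; [lra|].
  pose proof (wave_derive_bounded _ _ Hw (B2 (Z.of_nat (S m)) xi z)); nra.
- apply (ex_series_scal_l (V := R_NormedModule) (2 * PI) (fun m => gamma ^ S m)).
  apply (ex_series_incr_1 (fun n => gamma ^ n)), ex_series_gamma.
- intros m; apply contracting_term, Hw.
Qed.

Definition Hcoord (phi : R -> R) (xi x : R) : R :=
  Series (fun n => Rpower 2 (- IZR (Z.of_nat n) / 2)
     * (phi (B2 (- Z.of_nat n) xi x) - phi (B2 (- Z.of_nat n) xi 0)))
  + Series (fun m => Rpower 2 (- IZR (- Z.of_nat (S m)) / 2)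
     * (phi (B2 (Z.of_nat (S m)) xi x) - phi (B2 (Z.of_nat (S m)) xi 0))).

Lemma Hcoord_increment (phi psi : R -> R) (xi x y : R) :
  is_wave phi psi -> 0 <= x <= 1 -> 0 <= y <= 1 ->
  Hcoord phi xi y - Hcoord phi xi x
  = Series (fun n => Rpower 2 (- INR n / 2) * phi (2 ^ n * y))
    - Series (fun n => Rpower 2 (- INR n / 2) * phi (2 ^ n * x))
    - RInt (fun z => - 2 * PI * Series (fun m =>
        gamma ^ S m * psi (B2 (Z.of_nat (S m)) xi z))) x y.
Proof.
intros Hw Hx Hy; unfold Hcoord.
rewrite !(expanding_half phi psi) by assumption.
pose proof (contracting_half phi psi xi 0 x Hw) as Hx0.
pose proof (contracting_half phi psi xi 0 y Hw) as Hy0.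
pose proof (is_RInt_Chasles _ _ _ _ _ _ (is_RInt_swap _ _ _ _ Hx0) Hy0) as Hxy.
rewrite (is_RInt_unique _ _ _ _ Hxy).
unfold plus, opp; simpl; ring.
Qed.

Theorem lemma3p2 :
  forall x y xi : R,
    0 <= x <= 1 -> 0 <= y <= 1 -> 0 <= xi <= 1 ->
    minus (Hfun xi y) (Hfun xi x) =
    minus (minus (Wcurve y) (Wcurve x)) (RInt2 (Sfun xi) x y).
Proof.
intros x y xi Hx Hy _.
pose proof (Hcoord_increment _ _ xi x y is_wave_cos Hx Hy) as Hcos.
pose proof (Hcoord_increment _ _ xi x y is_wave_sin Hx Hy) as Hsin.
(* The coordinates of both sides compute to the two increments. *)
exact (f_equal2 pair Hcos Hsin).
Qed.
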